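(* Let $f$ be a (left slice) regular function on a circular s-domain $\Omega\subseteq\mathbb{H}$. Choose any $J\in\mathbb{S}$. Then the following equality holds for all $q=x+yI\in\Omega$ ($x,y\in\mathbb{R}$, $I\in\mathbb{S}$): $$f(x+yI)=\frac12\Big[f(x+yJ)+f(x-yJ)\Big]+I\,\frac12\Big[J\big[f(x-yJ)-f(x+yJ)\big]\Big].$$ Moreover, for all $x,y\in\mathbb{R}$ such that $x+y\mathbb{S}\subseteq\Omega$, there exist $b,c\in\mathbb{H}$ such that for all $K\in\mathbb{S}$ $$\frac12\Big[f(x+yK)+f(x-yK)\Big]=b\qquad\text{and}\qquad \frac12\Big[K\big[f(x-yK)-f(x+yK)\big]\Big]=c.$$
   Context: $\mathbb{H}$ is the real algebra of quaternions; $\mathbb{S}=\{q\in\mathbb{H}: \mathrm{Re}(q)=0,\ |q|=1\}$ is the 2-sphere of imaginary units. For $I\in\mathbb{S}$, $L_I=\mathbb{R}+I\mathbb{R}$. A function $f:U\to\mathbb{H}$ on an open set $U\subseteq\mathbb{H}$ is (left slice) regular if for every $I\in\mathbb{S}$ the restriction $f_I$ of $f$ to $U\cap L_I$ is real differentiable and $\frac12\left(\frac{\partial}{\partial x}+I\frac{\partial}{\partial y}\right)f_I(x+yI)=0$. A domain is a nonempty connected open set. A domain $\Omega\subseteq\mathbb{H}$ is a slice domain (s-domain) if $\Omega\cap\mathbb{R}\neq\emptyset$ and $\Omega\cap L_I$ is a domain in $L_I$ for all $I\in\mathbb{S}$. A set $\Omega\subseteq\mathbb{H}$ is circular if $x+yI\in\Omega$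 (with $x,y\in\mathbb{R}$, $I\in\mathbb{S}$) implies $x+y\mathbb{S}=\{x+yJ: J\in\mathbb{S}\}\subseteq\Omega$. *)

(* Defs.v *)
From HB Require Import structures.
From mathcomp Require Import all_boot all_order all_algebra.
From mathcomp Require Import all_classical all_reals all_analysis.
From mathcomp Require Import ring lra.

Set Implicit Arguments.
Unset Strict Implicit.
Unset Printing Implicit Defensive.

Import Order.TTheory GRing.Theory Num.Theory.
Import numFieldNormedType.Exports.

Local Open Scope classical_set_scope.
Local Open Scope ring_scope.

(* Quat a b c d is the quaternion a + b i + c j + d k. *)
Record quaternion (R : Type) : Type :=
  Quat { qRe : R; qIi : R; qIj : R; qIk : R }.

Section Quaternion_choice.
Variable T : Type.

Definition quat_tuple (q : quaternion T) : T * T * T * T :=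
  (qRe q, qIi q, qIj q, qIk q).

Definition tuple_quat (t : T * T * T * T) : quaternion T :=
  Quat t.1.1.1 t.1.1.2 t.1.2 t.2.

Lemma quat_tupleK : cancel quat_tuple tuple_quat.
Proof. by case. Qed.

End Quaternion_choice.

HB.instance Definition _ (T : eqType) :=
  Equality.copy (quaternion T) (can_type (@quat_tupleK T)).
HB.instance Definition _ (T : choiceType) :=
  Choice.copy (quaternion T) (can_type (@quat_tupleK T)).

Section Quaternion_algebra.
Variable R : realType.
Local Notation H := (quaternion R).
Implicit Types p q r : H.

Definition quat0 : H := Quat 0 0 0 0.
Definition quat1 : H := Quat 1 0 0 0.

Definition quat_opp q : H :=
  let: Quat a b c d := q in Quat (- a) (- b) (- c) (- d).

Definition quat_add p q : H :=
  let: Quat a b c d := p in let: Quat a' b' c' d' := q in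
  Quat (a + a') (b + b') (c + c') (d + d').

Definition quat_scale (l : R) q : H :=
  let: Quat a b c d := q in Quat (l * a) (l * b) (l * c) (l * d).

Definition quat_mul p q : H :=
  let: Quat a b c d := p in let: Quat a' b' c' d' := q in
  Quat (a * a' - b * b' - c * c' - d * d')
       (a * b' + b * a' + c * d' - d * c')
       (a * c' - b * d' + c * a' + d * b')
       (a * d' + b * c' - c * b' + d * a').

Definition quat_norm q : R :=
  let: Quat a b c d := q in
  Num.sqrt (a ^+ 2 + b ^+ 2 + c ^+ 2 + d ^+ 2).

Lemma quat_addA : associative quat_add.
Proof. by case=> ? ? ? ? [? ? ? ?] [? ? ? ?]; congr Quat; ring. Qed.

Lemma quat_addC : commutative quat_add.
Proof. by case=> ? ? ? ? [? ? ? ?]; congr Quat; ring. Qed.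

Lemma quat_add0 : left_id quat0 quat_add.
Proof. by case=> ? ? ? ?; congr Quat; ring. Qed.

Lemma quat_addN : left_inverse quat0 quat_opp quat_add.
Proof. by case=> ? ? ? ?; congr Quat; ring. Qed.

HB.instance Definition _ :=
  GRing.isZmodule.Build H quat_addA quat_addC quat_add0 quat_addN.

Lemma quat_scaleA l m q : quat_scale l (quat_scale m q) = quat_scale (l * m) q.
Proof. by case: q => ? ? ? ?; congr Quat; ring. Qed.

Lemma quat_scale1 : left_id 1 quat_scale.
Proof. by case=> ? ? ? ?; congr Quat; ring. Qed.

Lemma quat_scaleDr : right_distributive quat_scale +%R.
Proof. by move=> l [? ? ? ?] [? ? ? ?]; congr Quat; ring. Qed.

Lemma quat_scaleDl q : {morph quat_scale^~ q : l m / l + m}.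
Proof. by case: q => ? ? ? ? l m; congr Quat; ring. Qed.

HB.instance Definition _ := GRing.Zmodule_isLmodule.Build R H
  quat_scaleA quat_scale1 quat_scaleDr quat_scaleDl.

Lemma quat_mulA : associative quat_mul.
Proof. by case=> ? ? ? ? [? ? ? ?] [? ? ? ?]; congr Quat; ring. Qed.

Lemma quat_mul1q : left_id quat1 quat_mul.
Proof. by case=> ? ? ? ?; congr Quat; ring. Qed.

Lemma quat_mulq1 : right_id quat1 quat_mul.
Proof. by case=> ? ? ? ?; congr Quat; ring. Qed.

Lemma quat_mulDl : left_distributive quat_mul +%R.
Proof. by case=> ? ? ? ? [? ? ? ?] [? ? ? ?]; congr Quat; ring. Qed.

Lemma quat_mulDr : right_distributive quat_mul +%R.
Proof. by case=> ? ? ? ? [? ? ? ?] [? ? ? ?]; congr Quat; ring. Qed.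

Lemma quat1_neq0 : quat1 != 0.
Proof. by apply/eqP => -[/eqP]; rewrite oner_eq0. Qed.

HB.instance Definition _ := GRing.Zmodule_isNzRing.Build H
  quat_mulA quat_mul1q quat_mulq1 quat_mulDl quat_mulDr quat1_neq0.

Lemma quat_scaleAl (l : R) p q : l *: (p * q) = (l *: p) * q.
Proof. by case: p q => ? ? ? ? [? ? ? ?]; congr Quat; ring. Qed.

HB.instance Definition _ := GRing.Lmodule_isLalgebra.Build R H quat_scaleAl.

Lemma quat_scaleAr (l : R) p q : l *: (p * q) = p * (l *: q).
Proof. by case: p q => ? ? ? ? [? ? ? ?]; congr Quat; ring. Qed.

HB.instance Definition _ := GRing.Lalgebra_isAlgebra.Build R H quat_scaleAr.

Lemma quat_normD p q : quat_norm (p + q) <= quat_norm p + quat_norm q.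
Proof.
case: p q => a b c d [a' b' c' d'] /=.
set s := a ^+ 2 + b ^+ 2 + c ^+ 2 + d ^+ 2.
set t := a' ^+ 2 + b' ^+ 2 + c' ^+ 2 + d' ^+ 2.
have s0 : 0 <= s by rewrite !addr_ge0 ?sqr_ge0.
have t0 : 0 <= t by rewrite !addr_ge0 ?sqr_ge0.
pose e := a * a' + b * b' + c * c' + d * d'.
have e_le : e <= Num.sqrt s * Num.sqrt t.
  rewrite -sqrtrM //; apply: le_trans (ler_norm _) _.
  rewrite -sqrtr_sqr ler_sqrt ?mulr_ge0 // -subr_ge0.
  have -> : s * t - e ^+ 2 =
      (a * b' - b * a') ^+ 2 + (a * c' - c * a') ^+ 2 + (a * d' - d * a') ^+ 2
    + (b * c' - c * b') ^+ 2 + (b * d' - d * b') ^+ 2 + (c * d' - d * c') ^+ 2.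
    by rewrite /s /t /e; ring.
  by rewrite !addr_ge0 ?sqr_ge0.
rewrite -[leRHS]ger0_norm ?addr_ge0 ?sqrtr_ge0 // -sqrtr_sqr.
rewrite ler_sqrt ?sqr_ge0 // [leRHS]sqrrD !sqr_sqrtr //.
have -> : (a + a') ^+ 2 + (b + b') ^+ 2 + (c + c') ^+ 2 + (d + d') ^+ 2
        = s + e *+ 2 + t by rewrite /s /t /e; ring.
by rewrite lerD2r lerD2l lerMn2r e_le orbT.
Qed.

Lemma quat_normZ (l : R) q : quat_norm (l *: q) = `|l| * quat_norm q.
Proof.
case: q => a b c d /=; rewrite -sqrtr_sqr -sqrtrM ?sqr_ge0 //.
by congr Num.sqrt; ring.
Qed.

Lemma quat_norm_eq0 q : quat_norm q = 0 -> q = 0.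
Proof.
case: q => a b c d /eqP /=; rewrite sqrtr_eq0 => le0.
have sqr0 (x : R) : x ^+ 2 <= 0 -> x = 0.
  by move=> x0; apply/eqP; rewrite -sqrf_eq0 eq_le x0 sqr_ge0.
have := (sqr_ge0 a, sqr_ge0 b, sqr_ge0 c, sqr_ge0 d) => -[[[? ?] ?] ?].
by congr Quat; apply: sqr0; lra.
Qed.

HB.instance Definition _ :=
  Lmodule_isNormed.Build R H quat_normD quat_normZ quat_norm_eq0.

End Quaternion_algebra.

Definition is_domain (T : topologicalType) (D : set T) : Prop :=
  [/\ D !=set0, connected D & open D].

Section Slice_regular.
Variable R : realType.
Local Notation H := (quaternion R).
Implicit Types (I : H) (U D : set H) (f : H -> H) (x y : R).

Definition imag_units : set H := [set q | qRe q = 0 /\ `|q| = 1].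

(* x%:A is the real number x seen as a quaternion. *)
Definition slice_point I x y : H := x%:A + y *: I.

Definition slice_plane I : set H :=
  [set q | exists x y, q = slice_point I x y].

Definition real_axis : set H := [set q | exists x : R, q = x%:A].

(* The sphere x + y S. *)
Definition slice_sphere x y : set H :=
  [set slice_point I x y | I in imag_units].

(* The restriction of f to the plane L_I in the coordinates (x, y) of x + y I;
   a function on U is represented by a total f, of which only the values on U
   matter because U is open. *)
Definition slice_fun f I (p : R * R) : H := f (slice_point I p.1 p.2).

Definition slice_regular U f : Prop :=
  open U /\
  forall I, imag_units I -> forall x y, U (slice_point I x y) ->
    differentiable (slice_fun f I) (x, y) /\
    2^-1 *: ('D_(1, 0) (slice_fun f I) (x, y)
             + I * 'D_(0, 1) (slice_fun f I) (x, y)) = 0.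

Definition slice_domain D : Prop :=
  [/\ is_domain D,
      D `&` real_axis !=set0
    & forall I, imag_units I ->
        is_domain (D `&` slice_plane I : set (subspace (slice_plane I)))].

Definition circular D : Prop :=
  forall I x y, imag_units I -> D (slice_point I x y) ->
    slice_sphere x y `<=` D.

End Slice_regular.

(* Main.v *)
Require Import Defs.
From HB Require Import structures.
From mathcomp Require Import all_boot all_order all_algebra.
From mathcomp Require Import all_classical all_reals all_analysis.
From mathcomp Require Import ring lra.
Import Order.TTheory GRing.Theory Num.Theory.
Import numFieldNormedType.Exports.
Local Open Scope classical_set_scope.
Local Open Scope ring_scope.

(** Fix imaginary units I and J and put a = (1 - I J) / 2, b = (1 + I J) / 2.
    Then a J = I a and b (- J) = I b, and so left multiplication by a (by b)
    turns a function satisfying the Cauchy-Riemann equation for J (for - J)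
    into one satisfying it for I.  Hence, on the part of the plane where
    x + y I lies in Omega,
      g (x, y) = f (x + y I) - a f (x + y J) - b f (x - y J)
    satisfies the Cauchy-Riemann equation for I.  It vanishes on the real axis
    because a + b = 1, and the identity principle gives g = 0: this is
    [representation_formula], the first claim up to expanding a and b.  The
    formula for one fixed J writes f (x + y I) as u + I v with u and v
    independent of I, and the second claim follows by taking I = K and I = - K.

    The identity principle [slice_identity] has to be proved for functions that
    are only differentiable, with no continuity of the derivative, so it rests
    on Goursat's argument.  For every quaternion m the real functions
    Re (m g) and - Re (m I g) are the real and imaginary part of a holomorphic
    function ([left_regular_holomorphic]); here complex numbers are pairs of
    reals.  These scalar functions have values in a commutative field, so they
    can be multiplied.

    The key fact is [square_centre]: a holomorphic function F that vanishes on
    one edge of a square vanishes at its centre.  The product of the four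
    functions z |-> F (i^k z) vanishes on the whole boundary and is invariant
    under z |-> i z, so F may be assumed invariant.  Write F = U + i V and let
    w = s (t - i), with 0 < s <= 1 and -1 <= t <= 1, run through the triangle
    between the centre and the bottom edge.  The real part of F (w) dw / w is
      U ds / s + (t U - V) / (t^2 + 1) dt,
    a closed form on [r, 1] x [-1, 1].  In Goursat's theorem the sides t = -1
    and t = 1 cancel by invariance and the side s = 1 contributes nothing;
    hence (t U - V) / (t^2 + 1) has integral 0 over the side s = r, and t U = V
    at some point of that side.  Letting r tend to 0 gives |V 0| <= |U 0|.
    Applied to i (F 0)^* F, whose value at 0 is i |F 0|^2, this gives F 0 = 0.

    Goursat's theorem itself ([goursat]) is stated with primitives instead of
    integrals: the integral of a form over the boundary of a rectangle becomes a
    mixed second difference, its additivity is an algebraic identity, and it is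
    estimated by the mean value theorem.

    Squares placed at suitable angles spread zeros.  From a real segment they
    reach a neighbourhood of its interior points ([zero_near_real_segment]);
    from a disc they reach the disc of twice the squared radius
    ([zero_disc_doubling]), so the interior of the zero set is relatively
    closed, and connectedness of the slice concludes. *)

Set Implicit Arguments.
Unset Strict Implicit.
Unset Printing Implicit Defensive.

(** * Goursat's theorem on rectangles *)

Section Rectangles.
Variable R : realType.
Implicit Types (a b c d e s t x y : R) (P Q W : R -> R -> R).

Lemma continuous_primitive (f : R -> R) a b : a < b ->
  {within `[a, b], continuous f} ->
  exists2 F : R -> R, {within `[a, b], continuous F} &
    forall x, x \in `]a, b[ -> is_derive x 1 F (f x).
Proof.
move=> ab fC.
have fi : lebesgue_measure.-integrable `[a, b] (EFin \o f).
  by apply: continuous_compact_integrable => //; exact: segment_compact.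
exists (fun x => parameterized_integral lebesgue_measure a x f).
  exact: parameterized_integral_continuous (ltW ab) fi.
move=> x xab.
have fx : {for x, continuous f}.
  apply: within_continuous_continuous fC _ => //.
have /andP[ax xb] : a < x < b by move: xab; rewrite in_itv.
have [dF FE] := continuous_FTC1_closed xb fi ax fx.
by rewrite -FE derive1E; exact/derivableP.
Qed.

(** Cousin's lemma: if the whole rectangle were bad, repeated quartering would
    produce nested bad rectangles shrinking to a point, which contradicts
    goodness of all small rectangles around that point. *)
Lemma rectangle_bisection (good : R -> R -> R -> R -> Prop) a b c d :
  a < b -> c < d ->
  (forall x x' y y',
    good x ((x + x') / 2) y ((y + y') / 2) ->
    good ((x + x') / 2) x' y ((y + y') / 2) ->
    good x ((x + x') / 2) ((y + y') / 2) y' ->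
    good ((x + x') / 2) x' ((y + y') / 2) y' -> good x x' y y') ->
  (forall s t, a <= s <= b -> c <= t <= d -> exists2 e, 0 < e &
    forall x x' y y', a <= x -> x <= s -> s <= x' -> x' <= b ->
      c <= y -> y <= t -> t <= y' -> y' <= d ->
      0 < x' - x < e -> 0 < y' - y < e -> good x x' y y') ->
  good a b c d.
Proof.
move=> ab cd quarter local; apply: contrapT => bad_abcd.
pose w n : R := (b - a) / 2 ^+ n; pose h n : R := (d - c) / 2 ^+ n.
have w_gt0 n : 0 < w n by rewrite divr_gt0 ?exprn_gt0 ?subr_gt0.
have h_gt0 n : 0 < h n by rewrite divr_gt0 ?exprn_gt0 ?subr_gt0.
have w0 n : 0 <= w n by exact: ltW.
have h0 n : 0 <= h n by exact: ltW.
have wS n : w n = 2 * w n.+1 by rewrite /w exprS; field.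
have hS n : h n = 2 * h n.+1 by rewrite /h exprS; field.
pose bad n (p : R * R) := [/\ a <= p.1, p.1 + w n <= b, c <= p.2, p.2 + h n <= d
  & ~ good p.1 (p.1 + w n) p.2 (p.2 + h n)].
pose next n (p q : R * R) := [/\ bad n.+1 q, p.1 <= q.1, q.1 <= p.1 + w n.+1,
  p.2 <= q.2 & q.2 <= p.2 + h n.+1].
have ex_next n p : bad n p -> exists q, next n p q.
  move=> [ap pb cp pd badp]; apply: contrapT => /forallNP nonext.
  have [wn hn] := (w0 n.+1, h0 n.+1).
  move: badp pb pd; rewrite wS hS => badp pb pd; apply: badp.
  have mx : (p.1 + (p.1 + 2 * w n.+1)) / 2 = p.1 + w n.+1 by field.
  have my : (p.2 + (p.2 + 2 * h n.+1)) / 2 = p.2 + h n.+1 by field.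
  have aux q : q.1 = p.1 \/ q.1 = p.1 + w n.+1 ->
      q.2 = p.2 \/ q.2 = p.2 + h n.+1 ->
      good q.1 (q.1 + w n.+1) q.2 (q.2 + h n.+1).
    move=> q1 q2; apply: contrapT => badq; apply: (nonext q).
    rewrite /next /bad.
    move: (w n.+1) (h n.+1) wn hn pb pd q1 q2 badq => wn hn wn0 hn0.
    move=> pb pd q1 q2 badq; clear -ap cp wn0 hn0 pb pd q1 q2 badq.
    by split; [split=> //| | | |]; case: q1 => q1; case: q2 => q2; lra.
  have dbl u v : u + 2 * v = u + v + v :> R by ring.
  apply: quarter; rewrite ?mx ?my.
  - exact: (aux p (or_introl erefl) (or_introl erefl)).
  - rewrite (dbl p.1); exact: (aux (_, _) (or_intror erefl) (or_introl erefl)).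
  - rewrite (dbl p.2); exact: (aux (_, _) (or_introl erefl) (or_intror erefl)).
  - rewrite (dbl p.1) (dbl p.2).
    exact: (aux (_, _) (or_intror erefl) (or_intror erefl)).
have bad0 : bad 0%N (a, c).
  by split=> //=; rewrite /w /h expr0 !divr1 ?subrKC.
(* F n is a bad rectangle of level n, given by its lower left corner. *)
pose F := fix F n : {p | bad n p} :=
  if n isn't m.+1 then exist _ (a, c) bad0 else
  let: exist p badp := F m in
  let: exist q nq := cid (ex_next m p badp) in
  exist _ q (let: And5 H _ _ _ _ := nq in H).
have nextF n : next n (sval (F n)) (sval (F n.+1)).
  rewrite /=; case: (F n) => p badp /=; case: cid => q nq /=; exact: nq.
pose u n := (sval (F n)).1; pose v n := (sval (F n)).2.
have nest (z r : nat -> R) : (forall n, z n <= z n.+1) ->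
    (forall n, z n.+1 <= z n + r n.+1) -> (forall n, r n = 2 * r n.+1) ->
    (forall n, 0 <= r n) -> exists s, forall n, z n <= s <= z n + r n.
  move=> zle zr rS r0.
  have zmono m n : (m <= n)%N -> z m <= z n.
    by move=> mn; apply: (@nondecreasing_seqP _ _ z).1.
  have zup m n : (m <= n)%N -> z n + r n <= z m + r m.
    move=> /subnK <-; elim: (n - m)%N => // k; apply: le_trans.
    by rewrite addSn; have := (zr (k + m)%N, rS (k + m)%N) => -[]; lra.
  have zbnd m n : z m <= z n + r n.
    have [mn|/ltnW nm] := leqP m n.
      by rewrite (le_trans (zmono _ _ mn))// lerDl.
    by rewrite (le_trans _ (zup _ _ nm))// lerDl.
  exists (sup (range z)) => n; apply/andP; split.
    apply: ub_le_sup; last by exists n.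
    by exists (z 0%N + r 0%N) => _ [m _ <-].
  by apply: ge_sup => [|_ [m _ <-]//]; exists (z 0%N), 0%N.
have [s us] := nest u w (fun n => let: And5 _ H _ _ _ := nextF n in H)
  (fun n => let: And5 _ _ H _ _ := nextF n in H) wS w0.
have [t vt] := nest v h (fun n => let: And5 _ _ _ H _ := nextF n in H)
  (fun n => let: And5 _ _ _ _ H := nextF n in H) hS h0.
have [e e0 he] : exists2 e, 0 < e & forall x x' y y',
    a <= x -> x <= s -> s <= x' -> x' <= b ->
    c <= y -> y <= t -> t <= y' -> y' <= d ->
    0 < x' - x < e -> 0 < y' - y < e -> good x x' y y'.
  apply: local.
    by have := us 0%N; rewrite /u /w/= expr0 divr1 subrKC.
  by have := vt 0%N; rewrite /v /h/= expr0 divr1 subrKC.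
have small r : exists N, forall n, (N <= n)%N -> r / 2 ^+ n < e.
  have := @cvg_geometric R r 2^-1.
  rewrite ger0_norm ?invr_ge0// invf_lt1 ?ltr1n// => /(_ isT).
  move/cvgrPdist_lt => /(_ _ e0) [N _ HN]; exists N => n Nn.
  have := HN n Nn; rewrite /= sub0r normrN /geometric/= exprVn.
  exact: le_lt_trans (ler_norm _).
have [N1 hN1] := small (b - a); have [N2 hN2] := small (d - c).
pose n := maxn N1 N2.
have [ux xb vy yd] := svalP (F n); apply.
have /andP[us1 us2] := us n; have /andP[vt1 vt2] := vt n.
by apply: he => //; rewrite addrAC subrr add0r ?w_gt0 ?h_gt0;
  [apply: hN1; rewrite leq_maxl|apply: hN2; rewrite leq_maxr].
Qed.

(** If W s is a primitive of q s for every s, this is the integral of the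
    one-form q s t dt over the two sides of the rectangle where s is constant. *)
Definition mixed_difference W a b c d := W b d - W b c - W a d + W a c.

Lemma distance_in_segment (r u u' s t : R) : u <= s -> s <= u' -> u' - u < r ->
  u <= t -> t <= u' -> `|t - s| < r /\ `|t - s| <= u' - u.
Proof. by move=> *; split; [rewrite ltr_norml|rewrite ler_norml]; lra. Qed.

(** Phat and Qhat are partial primitives of the form P ds + Q dt, so the
    conclusion says that its integral over the boundary of the rectangle is 0.
    The estimate in the hypothesis is differentiability, the common k being the
    closedness condition.  Closedness is used pointwise only: the mixed
    difference M of Qhat minus Phat is additive under quartering, and on a small
    rectangle around (s, t) the mean value theorem turns it into increments of Q
    and P whose linear parts cancel, so M is at most e times the square of the
    half-perimeter.  Bisection extends this bound to the whole rectangle. *)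
Lemma goursat (P Q Phat Qhat : R -> R -> R) a b c d : a < b -> c < d ->
  (forall s, s \in `[a, b] -> {within `[c, d], continuous Qhat s} /\
     forall t, t \in `]c, d[ -> is_derive t 1 (Qhat s) (Q s t)) ->
  (forall t, t \in `[c, d] -> {within `[a, b], continuous (Phat^~ t)} /\
     forall s, s \in `]a, b[ -> is_derive s 1 (Phat^~ t) (P s t)) ->
  (forall s t, s \in `[a, b] -> t \in `[c, d] -> exists p q k,
     forall e, 0 < e -> exists2 r : R, 0 < r & forall s' t',
       `|s' - s| < r -> `|t' - t| < r ->
       `|P s' t' - (P s t + p * (s' - s) + k * (t' - t))|
          <= e * (`|s' - s| + `|t' - t|) /\
       `|Q s' t' - (Q s t + k * (s' - s) + q * (t' - t))|
          <= e * (`|s' - s| + `|t' - t|)) ->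
  mixed_difference Qhat a b c d = mixed_difference Phat a b c d.
Proof.
move=> ab cd HQ HP Hd.
pose M x x' y y' := mixed_difference Qhat x x' y y' - mixed_difference Phat x x' y y'.
suff est e : 0 < e -> `|M a b c d| <= e * ((b - a) + (d - c)) ^+ 2.
  apply/eqP; rewrite -subr_eq0 -normr_le0; apply/ler_addgt0Pl => e e0.
  have S0 : 0 < ((b - a) + (d - c)) ^+ 2 by rewrite exprn_gt0// addr_gt0 ?subr_gt0.
  have := est (e / ((b - a) + (d - c)) ^+ 2).
  by rewrite divfK ?gt_eqF// addr0; apply; rewrite divr_gt0.
move=> e0; apply: (@rectangle_bisection (fun x x' y y' =>
  `|M x x' y y'| <= e * ((x' - x) + (y' - y)) ^+ 2)); rewrite ?ltW//.
  move=> x x' y y'.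
  set mx := (x + x') / 2; set my := (y + y') / 2 => g1 g2 g3 g4.
  have -> : M x x' y y' = M x mx y my + M mx x' y my + M x mx my y' + M mx x' my y'.
    by rewrite /M /mixed_difference; ring.
  have -> : e * ((x' - x) + (y' - y)) ^+ 2 =
      e * ((mx - x) + (my - y)) ^+ 2 + e * ((x' - mx) + (my - y)) ^+ 2
    + e * ((mx - x) + (y' - my)) ^+ 2 + e * ((x' - mx) + (y' - my)) ^+ 2.
    by rewrite /mx /my; field.
  by do 3 (rewrite (le_trans (ler_normD _ _))// lerD//).
move=> s t sab tcd.
have [||p [q [k]]] := Hd s t; rewrite ?in_itv// => /(_ (e / 2)).
rewrite divr_gt0// => /(_ isT)[r r0 Hr]; exists r => //.
move=> x x' y y' ax xs sx' x'b cy yt ty' y'd /andP[xx' xr] /andP[yy' yr].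
have sub (z z' : R) l m (f : R -> R) : l <= z -> z' <= m ->
    {within `[l, m], continuous f} -> {within `[z, z'], continuous f}.
  by move=> ? ?; apply: continuous_subspaceW; apply: subset_itv; rewrite bnd_simp.
have [CQ dQ] : {within `[y, y'], continuous (Qhat x' \- Qhat x)} /\
    forall t, t \in `]y, y'[ -> is_derive t 1 (Qhat x' \- Qhat x) (Q x' t - Q x t).
  have [|C1 D1] := HQ x'; first by rewrite in_itv/=; lra.
  have [|C2 D2] := HQ x; first by rewrite in_itv/=; lra.
  split=> [|z zy].
    by move=> z; apply: cvgB; [exact: (sub _ _ _ _ _ cy y'd C1)
                              |exact: (sub _ _ _ _ _ cy y'd C2)].
  have zcd : z \in `]c, d[ by move: zy; rewrite !in_itv/=; lra.
  by apply: is_deriveB; [exact: D1|exact: D2].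
have [CP dP] : {within `[x, x'], continuous (Phat^~ y' \- Phat^~ y)} /\
    forall s, s \in `]x, x'[ -> is_derive s 1 (Phat^~ y' \- Phat^~ y) (P s y' - P s y).
  have [|C1 D1] := HP y'; first by rewrite in_itv/=; lra.
  have [|C2 D2] := HP y; first by rewrite in_itv/=; lra.
  split=> [|z zy].
    by move=> z; apply: cvgB; [exact: (sub _ _ _ _ _ ax x'b C1)
                              |exact: (sub _ _ _ _ _ ax x'b C2)].
  have zab : z \in `]a, b[ by move: zy; rewrite !in_itv/=; lra.
  by apply: is_deriveB; [exact: D1|exact: D2].
(* Both mean values reduce M to first increments of Q and of P. *)
have [|tau tauy Qtau] := MVT _ dQ CQ; first by rewrite -subr_gt0.
have [|sigma sigmax Psigma] := MVT _ dP CP; first by rewrite -subr_gt0.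
have -> : M x x' y y' =
    (Q x' tau - Q x tau) * (y' - y) - (P sigma y' - P sigma y) * (x' - x).
  by rewrite -Qtau -Psigma /M /mixed_difference /=; ring.
move: tauy sigmax; rewrite !in_itv/= => /andP[yt1 yt2] /andP[xs1 xs2].
have [bx1 bx2] := distance_in_segment xs sx' xr (lexx _) (le_trans xs sx').
have [bx'1 bx'2] := distance_in_segment xs sx' xr (le_trans xs sx') (lexx _).
have [bs1 bs2] := distance_in_segment xs sx' xr (ltW xs1) (ltW xs2).
have [by1 by2] := distance_in_segment yt ty' yr (lexx _) (le_trans yt ty').
have [by'1 by'2] := distance_in_segment yt ty' yr (le_trans yt ty') (lexx _).
have [bt1 bt2] := distance_in_segment yt ty' yr (ltW yt1) (ltW yt2).
set S := (x' - x) + (y' - y).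
have eS u v : u <= x' - x -> v <= y' - y -> e / 2 * (u + v) <= e / 2 * S.
  by move=> ? ?; rewrite ler_wpM2l ?lerD// divr_ge0// ltW.
have [_ /le_trans/(_ (eS _ _ bx2 bt2))] := Hr x tau bx1 bt1.
have [_ /le_trans/(_ (eS _ _ bx'2 bt2))] := Hr x' tau bx'1 bt1.
have [/le_trans/(_ (eS _ _ bs2 by2)) + _] := Hr sigma y bs1 by1.
have [/le_trans/(_ (eS _ _ bs2 by'2)) + _] := Hr sigma y' bs1 by'1.
set ep' := P sigma y' - _; set ep := P sigma y - _.
set eq' := Q x' tau - _; set eq := Q x tau - _.
move=> Ep' Ep Eq' Eq.
have -> : (Q x' tau - Q x tau) * (y' - y) - (P sigma y' - P sigma y) * (x' - x) =
    (eq' - eq) * (y' - y) - (ep' - ep) * (x' - x).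
  by rewrite /eq /eq' /ep /ep'; ring.
have W : 0 <= x' - x := ltW xx'; have H : 0 <= y' - y := ltW yy'.
have two (u v l : R) : `|u| <= e / 2 * S -> `|v| <= e / 2 * S -> 0 <= l ->
    `|(u - v) * l| <= e * S * l.
  move=> ? ? l0; rewrite normrM (ger0_norm l0) ler_wpM2r//.
  by rewrite (le_trans (ler_normB _ _))// [e](splitr e) mulrDl lerD.
rewrite (le_trans (ler_normB _ _))//.
rewrite (le_trans (lerD (two _ _ _ Eq' Eq H) (two _ _ _ Ep' Ep W)))//.
rewrite le_eqVlt; apply/orP; left; apply/eqP; rewrite /S; ring.
Qed.

End Rectangles.

(** * Closed differential forms on a rectangle *)

Section PlaneDifferentials.
Variable R : realType.
Implicit Types (a b c d s t : R) (p v : R * R) (P Q f : R * R -> R).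

Lemma is_diff_estimate f (df : R * R -> R) p e : is_diff p f df -> 0 < e ->
  exists2 r : R, 0 < r & forall s t, `|s - p.1| < r -> `|t - p.2| < r ->
    `|f (s, t) - (f p + df (s - p.1, t - p.2))| <= e * (`|s - p.1| + `|t - p.2|).
Proof.
move=> fp e0.
have /diff_locallyP[_ /eqaddoP/(_ e e0)] : differentiable f p by exact: ex_diff.
rewrite diff_val => /nbhs_norm0P[r /= r0 Hr]; exists r => // s t sp tp.
have := Hr (s - p.1, t - p.2).
rewrite /= prod_normE /= gt_max sp tp => /(_ isT).
have pst : (s - p.1, t - p.2) + p = (s, t).
  by case: p {fp Hr sp tp} => x y; congr pair; rewrite /= subrK.
rewrite [X in `|X|](_ : _ = f ((s - p.1, t - p.2) + p)
  - (f p + df (s - p.1, t - p.2)))// pst.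
move=> /le_trans; apply; apply: ler_wpM2l; first exact: ltW.
rewrite ge_max.
by rewrite lerDl lerDr !normr_ge0.
Qed.

Lemma is_diff_continuous f (df : R * R -> R) p : is_diff p f df ->
  {for p, continuous f}.
Proof. by move=> ?; apply: differentiable_continuous; exact: ex_diff. Qed.

(** Over the boundary, the sides where p.2 is c or d cancel and the side where
    p.1 is b contributes 0, so the integral of Q (a, t) dt from c to d is 0;
    by the mean value theorem for a primitive, its integrand has a zero. *)
Lemma closed_form_zero P Q a b c d : a < b -> c < d ->
  (forall p, p.1 \in `[a, b] -> p.2 \in `[c, d] -> exists p1 q2 k : R,
     is_diff p P (fun v => p1 * v.1 + k * v.2) /\
     is_diff p Q (fun v => k * v.1 + q2 * v.2)) ->
  (forall s, s \in `[a, b] -> P (s, c) = P (s, d)) ->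
  (forall t, t \in `[c, d] -> Q (b, t) = 0) ->
  exists2 t, t \in `]c, d[ & Q (a, t) = 0.
Proof.
move=> ab cd dPQ Pcd Qb.
have [Qhat HQ] : exists Qhat : R -> R -> R, forall s, s \in `[a, b] ->
    {within `[c, d], continuous Qhat s} /\
    forall t, t \in `]c, d[ -> is_derive t 1 (Qhat s) (Q (s, t)).
  suff /choice[G HG] : forall s, exists F : R -> R, s \in `[a, b] ->
      {within `[c, d], continuous F} /\
      forall t, t \in `]c, d[ -> is_derive t 1 F (Q (s, t)) by exists G.
  move=> s; have [sab|nsab] := boolP (s \in `[a, b]); last by exists (cst 0).
  have [|F CF dF] := @continuous_primitive _ (fun t => Q (s, t)) _ _ cd.
    2: by exists F.
  apply: continuous_in_subspaceT => t; rewrite inE/= => tcd.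
  have [p1 [q2 [k [_ /is_diff_continuous Qst]]]] := dPQ (s, t) sab tcd.
  suff : {for t, continuous (Q \o (fun t => (s, t)))} by [].
  apply: continuous_comp => //.
  by apply: differentiable_continuous; apply: differentiable_pair.
have [Phat HP] : exists Phat : R -> R -> R, forall t, t \in `[c, d] ->
    {within `[a, b], continuous (Phat^~ t)} /\
    forall s, s \in `]a, b[ -> is_derive s 1 (Phat^~ t) (P (s, t)).
  suff /choice[G HG] : forall t, exists F : R -> R, t \in `[c, d] ->
      {within `[a, b], continuous F} /\
      forall s, s \in `]a, b[ -> is_derive s 1 F (P (s, t)).
    by exists (fun s t => G t s).
  move=> t; have [tcd|ntcd] := boolP (t \in `[c, d]); last by exists (cst 0).
  have [|F CF dF] := @continuous_primitive _ (fun s => P (s, t)) _ _ ab.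
    2: by exists F.
  apply: continuous_in_subspaceT => s; rewrite inE/= => sab.
  have [p1 [q2 [k [/is_diff_continuous Pst _]]]] := dPQ (s, t) sab tcd.
  suff : {for s, continuous (P \o (fun s => (s, t)))} by [].
  apply: continuous_comp => //.
  by apply: differentiable_continuous; apply: differentiable_pair.
have [] : mixed_difference Qhat a b c d = mixed_difference Phat a b c d /\
    a \in `[a, b] /\ b \in `[a, b] /\ c \in `[c, d] /\ d \in `[c, d].
  split; last by rewrite !in_itv/= !lexx !ltW.
  apply: (@goursat _ (fun s t => P (s, t)) (fun s t => Q (s, t))) => // s t sab tcd.
  have [p1 [q2 [k [dP dQ]]]] := dPQ (s, t) sab tcd.
  exists p1, q2, k => e e0.
  have [r1 r10 h1] := is_diff_estimate dP e0.
  have [r2 r20 h2] := is_diff_estimate dQ e0.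
  exists (Num.min r1 r2); first by rewrite lt_min r10.
  move=> s' t'; rewrite !lt_min => /andP[s1 s2] /andP[t1 t2].
  by rewrite -![_ + _ + _ * (t' - t)]addrA; split; [exact: h1|exact: h2].
move=> PQ [aab [bab [ccd dcd]]].
have [sigma sab] : exists2 s, s \in `]a, b[ &
    (Phat^~ d \- Phat^~ c) b - (Phat^~ d \- Phat^~ c) a =
    (P (s, d) - P (s, c)) * (b - a).
  have [[C1 D1] [C2 D2]] := (HP d dcd, HP c ccd).
  apply: (MVT (f := Phat^~ d \- Phat^~ c)
              (df := fun s => P (s, d) - P (s, c)) ab) => [s sab|].
    by apply: is_deriveB; [exact: D1|exact: D2].
  by move=> s; apply: cvgB; [exact: C1|exact: C2].
rewrite Pcd ?subrr ?mul0r; last exact: subset_itv_oo_cc.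
move=> Pzero.
have [[Ca Da] [Cb Db]] := (HQ a aab, HQ b bab).
have [tb tbcd] := MVT cd Db Cb; rewrite Qb ?mul0r; last exact: subset_itv_oo_cc.
move=> Qbzero.
have [ta tacd Qa] := MVT cd Da Ca; exists ta => //.
have : Q (a, ta) * (d - c) = 0.
  rewrite -Qa; move: PQ Pzero Qbzero; rewrite /mixed_difference /=.
  lra.
by move=> /eqP; rewrite mulf_eq0 subr_eq0 (gt_eqF cd) orbF => /eqP.
Qed.

End PlaneDifferentials.

(** * Holomorphic functions as maps of the real plane *)

Section PointwiseRules.
Variable R : realType.
Implicit Types (p v : R * R) (f g df dg : R * R -> R) (F dF G dG : R * R -> R * R).

(** Makes the computed differential match the one required by the context. *)
Lemma is_diff_ext (V W : normedModType R) (f df dg : V -> W) (p : V) :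
  is_diff p f df -> (forall v : V, df v = dg v) -> is_diff p f dg.
Proof. by move=> fp /funext <-. Qed.

Lemma is_diff_proj1 p : is_diff p (fun q : R * R => q.1) (fun v => v.1).
Proof.
have fst_linear : linear (fun q : R * R => q.1) by [].
pose fstM := GRing.isLinear.Build _ _ _ _ _ fst_linear.
pose fstL : {linear (R * R)%type -> R} := HB.pack (fun q : R * R => q.1) fstM.
have fstC : continuous fstL by move=> q; exact: cvg_fst.
apply: DiffDef; first exact: (linear_differentiable p fstC).
exact: (diff_lin p fstC).
Qed.

Lemma is_diff_proj2 p : is_diff p (fun q : R * R => q.2) (fun v => v.2).
Proof.
have snd_linear : linear (fun q : R * R => q.2) by [].
pose sndM := GRing.isLinear.Build _ _ _ _ _ snd_linear.
pose sndL : {linear (R * R)%type -> R} := HB.pack (fun q : R * R => q.2) sndM.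
have sndC : continuous sndL by move=> q; exact: cvg_snd.
apply: DiffDef; first exact: (linear_differentiable p sndC).
exact: (diff_lin p sndC).
Qed.

Lemma is_diff_mul f df g dg p : is_diff p f df -> is_diff p g dg ->
  is_diff p (fun q => f q * g q) (fun v => f p * dg v + df v * g p).
Proof.
move=> dfp dgp; apply: is_diff_ext (is_diffM dfp dgp) _ => v.
by congr (_ + _); exact: mulrC.
Qed.

Lemma is_diff_add f df g dg p : is_diff p f df -> is_diff p g dg ->
  is_diff p (fun q => f q + g q) (fun v => df v + dg v).
Proof. by move=> dfp dgp; apply: is_diffD. Qed.

Lemma is_diff_sub f df g dg p : is_diff p f df -> is_diff p g dg ->
  is_diff p (fun q => f q - g q) (fun v => df v - dg v).
Proof. by move=> dfp dgp; apply: is_diffB. Qed.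

Lemma is_diff_const (a : R) p : is_diff p (fun _ => a) (fun _ => 0).
Proof. exact: is_diff_cst. Qed.

Lemma is_diff_inv f df p : is_diff p f df -> f p != 0 ->
  is_diff p (fun q => (f q)^-1) (fun v => - (df v / f p ^+ 2)).
Proof.
move=> dfp fp0; apply: DiffDef; first by apply: differentiableV => //; exact: ex_diff.
rewrite diffV// diff_val; apply/funext => v.
by rewrite -[LHS]/(- f p ^- 2 * df v) mulNr mulrC.
Qed.

Lemma is_diff_compose (U V W : normedModType R) (g dg : U -> V) (h dh : V -> W)
    (u : U) : is_diff u g dg -> is_diff (g u) h dh ->
  is_diff u (fun z => h (g z)) (fun w => dh (dg w)).
Proof. by move=> dgu dhu; apply: is_diff_comp. Qed.

Lemma is_diff_re F dF p : is_diff p F dF ->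
  is_diff p (fun q => (F q).1) (fun v => (dF v).1).
Proof. by move=> dFp; exact: is_diff_compose dFp (is_diff_proj1 _). Qed.

Lemma is_diff_im F dF p : is_diff p F dF ->
  is_diff p (fun q => (F q).2) (fun v => (dF v).2).
Proof. by move=> dFp; exact: is_diff_compose dFp (is_diff_proj2 _). Qed.

(** Complex multiplication on pairs of reals; the ring structure of the product
    type multiplies componentwise. *)
Definition cmul (z w : R * R) : R * R :=
  (z.1 * w.1 - z.2 * w.2, z.1 * w.2 + z.2 * w.1).

Definition csqnorm (z : R * R) : R := z.1 ^+ 2 + z.2 ^+ 2.

(** The Cauchy-Riemann equations say that the real differential is
    multiplication by a complex number, which is then the derivative. *)
Definition holomorphic_at F p := exists D, is_diff p F (cmul D).

Lemma csqnorm_cmul z w : csqnorm (cmul z w) = csqnorm z * csqnorm w.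
Proof. by rewrite /csqnorm /cmul /=; ring. Qed.

Lemma csqnorm_ge0 z : 0 <= csqnorm z.
Proof. by rewrite addr_ge0 ?sqr_ge0. Qed.

Lemma csqnorm_eq0 z : csqnorm z = 0 -> z = 0.
Proof.
case: z => x y /eqP; rewrite /csqnorm/= paddr_eq0 ?sqr_ge0// !sqrf_eq0.
by move=> /andP[/eqP -> /eqP ->].
Qed.

Lemma is_diff_cmul F dF G dG p : is_diff p F dF -> is_diff p G dG ->
  is_diff p (fun q => cmul (F q) (G q))
    (fun v => cmul (F p) (dG v) + cmul (dF v) (G p)).
Proof.
move=> dFp dGp.
have [F1 F2] := (is_diff_re dFp, is_diff_im dFp).
have [G1 G2] := (is_diff_re dGp, is_diff_im dGp).
have dre := is_diff_sub (is_diff_mul F1 G1) (is_diff_mul F2 G2).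
have dim := is_diff_add (is_diff_mul F1 G2) (is_diff_mul F2 G1).
apply: is_diff_ext (is_diff_pair dre dim) _ => v.
by rewrite /cmul; congr pair => /=; ring.
Qed.

Lemma holomorphic_mul F G p : holomorphic_at F p -> holomorphic_at G p ->
  holomorphic_at (fun q => cmul (F q) (G q)) p.
Proof.
move=> [D dF] [E dG]; exists (cmul (F p) E + cmul D (G p)).
apply: is_diff_ext; first exact: is_diff_cmul dF dG.
by move=> v; rewrite /cmul; congr pair => /=; ring.
Qed.

Lemma holomorphic_affine F c w p : holomorphic_at F (c + cmul w p) ->
  holomorphic_at (fun z => F (c + cmul w z)) p.
Proof.
move=> [D dF]; exists (cmul D w).
have dA : is_diff p (fun z => c + cmul w z) (cmul w).
  apply: is_diff_ext; first apply: is_diffD (is_diff_cst _ _)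
    (is_diff_cmul (is_diff_cst w _) (is_diff_id _)).
  by move=> v; rewrite /cmul; congr pair => /=; ring.
apply: is_diff_ext (is_diff_compose dA dF) _.
by move=> v; rewrite /cmul; congr pair => /=; ring.
Qed.

End PointwiseRules.

(** * Zeros on an edge of a square *)

Section SquareCentre.
Variable R : realType.
Implicit Types (x y r s t : R) (p v w z : R * R) (F : R * R -> R * R).

Definition square : set (R * R) := [set z | `|z.1| <= 1 /\ `|z.2| <= 1].

(** Goursat's theorem for the real part of F (w) dw / w in the coordinates
    w = s (t - i), on [r, 1] x [-1, 1]: here P and Q are the coefficients of ds
    and dt.  They satisfy dP/dt = dQ/ds, both being the real part of F'. *)
Lemma bottom_edge_argument F r :
  (forall z, square z -> holomorphic_at F z) ->
  (forall z, F (cmul (0, 1) z) = F z) ->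
  (forall x, `|x| <= 1 -> F (x, -1) = 0) ->
  0 < r < 1 ->
  exists2 t, t \in `]-1, 1[ & t * (F (r * t, - r)).1 = (F (r * t, - r)).2.
Proof.
move=> Fholo Frot Fbot /andP[r0 r1].
pose phi p : R * R := (p.1 * p.2, - p.1).
pose U p := (F (phi p)).1; pose V p := (F (phi p)).2.
pose P p := U p * (p.1)^-1; pose Q p := (p.2 * U p - V p) * (p.2 * p.2 + 1)^-1.
have ltN11 : -1 < 1 :> R by lra.
have nz t : t * t + 1 != 0 by rewrite gt_eqF// ltr_wpDl// -expr2 sqr_ge0.
have [p psr pst|s sr|t t1|t t1 /eqP] :=
    @closed_form_zero _ P Q r 1 (-1) 1 r1 ltN11.
- move: psr pst; rewrite !in_itv/= => /andP[rp p1] /andP[pN1 p2].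
  have p0 : 0 < p.1 by exact: lt_le_trans rp.
  have [|[A B] dF] := Fholo (phi p).
    rewrite /square/= normrN normrM (gtr0_norm p0) p1; split=> //.
    by apply: mulr_ile1 => //; [exact: ltW|rewrite ler_norml pN1].
  have d1 := is_diff_proj1 p; have d2 := is_diff_proj2 p.
  have dphi : is_diff p phi (fun v => (p.1 * v.2 + v.1 * p.2, - v.1)).
    have dN : is_diff p (fun q : R * R => - q.1) (fun v => - v.1) by exact: is_diffN.
    exact: is_diff_pair (is_diff_mul d1 d2) dN.
  have dF' := is_diff_compose dphi dF.
  have dU := is_diff_re dF'; have dV := is_diff_im dF'.
  have dP := is_diff_mul dU (is_diff_inv d1 (lt0r_neq0 p0)).
  have dS := is_diff_add (is_diff_mul d2 d2) (is_diff_const 1 p).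
  have dQ := is_diff_mul (is_diff_sub (is_diff_mul d2 dU) dV)
    (is_diff_inv dS (nz p.2)).
  (* A + B i is the derivative of F at phi p; dP/dt = dQ/ds = A. *)
  exists ((A * p.2 + B) / p.1 - U p / p.1 ^+ 2).
  exists (((U p + p.2 * (p.1 * A) - p.1 * B) * (p.2 * p.2 + 1)
    - (p.2 * U p - V p) * (2 * p.2)) / (p.2 * p.2 + 1) ^+ 2).
  exists A; split.
    by apply: is_diff_ext dP _ => v; rewrite /cmul/= /U /V; field; rewrite gt_eqF.
  apply: is_diff_ext dQ _ => v; rewrite /cmul/= /U /V; field; exact: nz.
- rewrite /P /U /phi /= -(Frot (s * -1, - s)) /cmul/=.
  by congr ((F (_, _)).1 / s); ring.
- rewrite /Q /U /V /phi /= mul1r Fbot ?mulr0 ?subrr ?mul0r//.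
  by move: t1; rewrite in_itv ler_norml.
rewrite /Q mulf_eq0 invr_eq0 (negPf (nz t)) orbF subr_eq0 => /eqP Qt.
by exists t.
Qed.

(** The points provided by [bottom_edge_argument] tend to the centre as r tends
    to 0, and at each of them |V| = |t U| <= |U|. *)
Lemma square_centre_le F :
  (forall z, square z -> holomorphic_at F z) ->
  (forall z, F (cmul (0, 1) z) = F z) ->
  (forall x, `|x| <= 1 -> F (x, -1) = 0) ->
  `|(F 0).2| <= `|(F 0).1|.
Proof.
move=> Fholo Frot Fbot; rewrite leNgt; apply/negP => UV.
have [|D dF] := Fholo 0; first by rewrite /square/= normr0 ler01.
pose gap z := `|(F z).2| - `|(F z).1|.
have gapC : {for (0 : R * R), continuous gap}.
  apply: cvgB; apply: cvg_norm.
    exact: is_diff_continuous (is_diff_im dF).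
  exact: is_diff_continuous (is_diff_re dF).
have : \forall z \near (0 : R * R), 0 < gap z.
  by apply: (cvgr_gt (gap 0) gapC); rewrite subr_gt0.
move=> /nbhs_norm0P[e /= e0 He].
pose r := Num.min (e / 2) 2^-1.
have r0 : 0 < r by rewrite lt_min divr_gt0 // invr_gt0 ltr0n.
have [|t] := @bottom_edge_argument F r Fholo Frot Fbot.
  by rewrite r0 gt_min invf_lt1// ltr1n orbT.
rewrite in_itv/= => /andP[t1 t2] tUV.
have /He : [set z : R * R | `|z| < e] (r * t, - r).
  have re : r < e by rewrite gt_min ltr_pdivrMr// ltr_pMr ?ltr1n.
  have tn : `|t| < 1 by rewrite ltr_norml t1.
  rewrite /= prod_normE/= gt_max normrN normrM (gtr0_norm r0) re andbT.
  by rewrite (le_lt_trans _ re)// ler_piMr ?ltW.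
rewrite /= /gap -tUV normrM subr_gt0 ltNge => /negP; apply.
by rewrite ler_piMl// ler_norml !ltW.
Qed.

(** Multiplying F by i times the conjugate of F 0 makes its value at 0 equal to
    i |F 0|^2, with real part 0; the previous bound kills the imaginary part. *)
Lemma symmetric_square_centre F :
  (forall z, square z -> holomorphic_at F z) ->
  (forall z, F (cmul (0, 1) z) = F z) ->
  (forall x, `|x| <= 1 -> F (x, -1) = 0) -> F 0 = 0.
Proof.
move=> Fholo Frot Fbot; pose m : R * R := ((F 0).2, (F 0).1).
have := @square_centre_le (fun z => cmul m (F z)).
rewrite {5 6}/cmul/=.
have -> : m.1 * (F 0).1 - m.2 * (F 0).2 = 0 by rewrite /m/=; ring.
have -> : m.1 * (F 0).2 + m.2 * (F 0).1 = csqnorm (F 0) by rewrite /m/= /csqnorm; ring.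
rewrite normr0 normr_le0 => H; apply/csqnorm_eq0/eqP/H.
- move=> z /Fholo; apply: holomorphic_mul; exists 0.
  by apply: is_diff_ext (is_diff_cst m z) _ => v; rewrite /cmul/= !mul0r subr0 addr0.
- by move=> z; rewrite Frot.
- by move=> x /Fbot ->; rewrite /cmul/= !mulr0 subr0 addr0.
Qed.

(** The product of the four rotates of F is invariant under rotation by i, and
    its value at the centre is the fourth power of that of F. *)
Lemma square_centre F :
  (forall z, square z -> holomorphic_at F z) ->
  (forall x, `|x| <= 1 -> F (x, -1) = 0) -> F 0 = 0.
Proof.
move=> Fholo Fbot.
pose rot z := cmul (0, 1) z.
pose G z :=
  cmul (cmul (F z) (F (rot z))) (cmul (F (rot (rot z))) (F (rot (rot (rot z))))).
have rot_square z : square z -> square (rot z).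
  by rewrite /square /rot /cmul/= !mul0r sub0r add0r !mul1r normrN => -[].
have rot4 z : rot (rot (rot (rot z))) = z.
  by case: z => x y; rewrite /rot /cmul/=; congr pair; ring.
have rot0 : rot 0 = 0 by rewrite /rot /cmul/= !mulr0 subr0 addr0.
have Grot z : G (rot z) = G z.
  by rewrite /G rot4 /cmul/=; congr pair; ring.
have rot_holo H z : holomorphic_at H (rot z) -> holomorphic_at (fun q => H (rot q)) z.
  have rotE q : rot q = 0 + rot q by rewrite add0r.
  rewrite rotE => /holomorphic_affine; rewrite (_ : (fun q => _) = (fun q => H (rot q)))//.
  by apply/funext => q; rewrite -rotE.
have G0 : G 0 = 0.
  apply: symmetric_square_centre => [z z1|//|x x1].
    apply: holomorphic_mul; apply: holomorphic_mul; first exact: Fholo.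
    - by apply/rot_holo/Fholo/rot_square.
    - by apply/(rot_holo (F \o rot))/rot_holo/Fholo/rot_square/rot_square.
    - apply/(rot_holo (F \o rot \o rot))/(rot_holo (F \o rot))/rot_holo/Fholo.
      exact/rot_square/rot_square/rot_square.
  by rewrite /G Fbot// /cmul/= !(mul0r, mulr0, subr0, addr0).
apply: csqnorm_eq0; have : csqnorm (G 0) = 0 by rewrite G0 /csqnorm/= expr0n addr0.
rewrite /G !rot0 !csqnorm_cmul -!expr2 => /eqP; rewrite !mulf_eq0 !orbb => /eqP//.
Qed.

(** As z runs through [square], c + w z runs through a square with centre c,
    arbitrarily scaled and rotated by the choice of w. *)
Lemma tilted_square_centre F c w :
  (forall z, square z -> holomorphic_at F (c + cmul w z)) ->
  (forall x, `|x| <= 1 -> F (c + cmul w (x, -1)) = 0) -> F c = 0.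
Proof.
move=> Fholo Fbot.
have := @square_centre (fun z => F (c + cmul w z)).
have -> : c + cmul w 0 = c.
  rewrite /cmul/= !mulr0 subrr addr0.
  by case: c {Fholo Fbot} => x y; congr pair; rewrite /= addr0.
by apply=> // z /Fholo; exact: holomorphic_affine.
Qed.

End SquareCentre.

(** * Propagation of zeros *)

Section ZeroSets.
Variable R : realType.
Implicit Types (x y r : R) (a p q z : R * R) (A D : set (R * R)).
Implicit Type F : R * R -> R * R.
Local Notation sqdist q p := (csqnorm (q - p)).

(** A point at height y above (or below) the segment is the centre of an upright
    square of half-side |y| with one edge inside the segment. *)
Lemma zero_near_real_segment F x0 r :
  (forall z, `|z.1 - x0| <= r -> `|z.2| <= 2 * r -> holomorphic_at F z) ->
  (forall x, `|x - x0| <= r -> F (x, 0) = 0) ->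
  forall z, `|z.1 - x0| + `|z.2| <= r -> F z = 0.
Proof.
move=> Fholo Freal [x y] /= xyr.
have near_x0 t : `|t| <= 1 -> `|x + y * t - x0| <= r.
  move=> t1; rewrite addrAC (le_trans (ler_normD _ _))// (le_trans _ xyr)// lerD2l.
  by rewrite normrM ler_piMr.
apply: (@tilted_square_centre _ _ _ (y, 0)) => [z [z1 z2]|t t1].
  apply: Fholo; rewrite /cmul/= ?mul0r ?subr0 ?addr0; first exact: near_x0.
  have yr : `|y| <= r by rewrite (le_trans _ xyr)// lerDr.
  rewrite (le_trans (ler_normD _ _))// mulr_natl mulr2n lerD// normrM.
  by rewrite (le_trans _ yr)// ler_piMr.
rewrite (_ : _ + _ = (x + y * t, 0)); first exact/Freal/near_x0.
by rewrite /cmul/=; congr pair; rewrite /=; ring.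
Qed.

(** Let c have squared distance N <= 2 r from a.  The square with centre c whose
    lower edge is perpendicular to the segment from a to c and passes through
    its midpoint has that edge within squared distance N (1/4 + 1/4) <= r of a,
    and lies entirely within squared distance N (9/4 + 1/4) <= 5 r. *)
Lemma zero_disc_doubling F a r :
  (forall z, sqdist z a <= 5 * r -> holomorphic_at F z) ->
  (forall z, sqdist z a <= r -> F z = 0) ->
  forall z, sqdist z a <= 2 * r -> F z = 0.
Proof.
move=> Fholo Fzero c car; set d := c - a.
have dE : c - a = d by [].
(* The scale - i d / 2 sends - i, the midpoint of the bottom edge, to - d / 2. *)
have dist z : sqdist (c + cmul (d.2 / 2, - (d.1 / 2)) z) a =
    sqdist c a * ((1 + z.2 / 2) ^+ 2 + (z.1 / 2) ^+ 2).
  by rewrite addrAC dE /csqnorm /cmul/=; ring.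
have sq x : `|x| <= 1 -> x ^+ 2 <= 1.
  by move=> x1; rewrite -real_normK ?num_real// expr_le1.
have c0 := csqnorm_ge0 (c - a).
apply: (@tilted_square_centre _ _ _ (d.2 / 2, - (d.1 / 2))) => [z [z1 z2]|t t1].
  apply: Fholo; rewrite dist.
  have /andP[z2l z2u] : -1 <= z.2 <= 1 by rewrite -ler_norml.
  have := sq _ z1; have := sq _ z2.
  rewrite !expr2; clear -c0 car z2u; move: (sqdist c a) c0 car => N; nra.
apply: Fzero; rewrite dist /=.
have := sq _ t1; rewrite !expr2; clear -c0 car; move: (sqdist c a) c0 car => N; nra.
Qed.

Lemma zero_disc_growth F a r M : 0 < r ->
  (forall z, sqdist z a <= 5 * M -> holomorphic_at F z) ->
  (forall z, sqdist z a <= r -> F z = 0) ->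
  forall z, sqdist z a <= M -> F z = 0.
Proof.
move=> r0 Fholo Fzero.
have [n Mn] : exists n, M <= 2 ^+ n * r.
  exists (Num.truncn (M / r)).+1; rewrite -ler_pdivrMr//.
  rewrite (le_trans (ltW (truncnS_gt _)))// -natrX ler_nat.
  exact/ltnW/ltn_expl.
elim: n r r0 Mn Fzero => [|n IHn] r r0 Mn Fzero z zM.
  by apply: Fzero; rewrite (le_trans zM)// -[leRHS]mul1r.
have [Mr|rM] := leP M r; first exact/Fzero/(le_trans zM).
apply: (IHn (2 * r)) zM; first by rewrite mulr_gt0.
  by rewrite mulrA -exprSr.
apply: zero_disc_doubling Fzero => q qr; apply: Fholo; rewrite (le_trans qr)//.
by rewrite ler_pM2l// ltW.
Qed.

Lemma open_sqdistP A : open A <->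
  forall p, A p -> exists2 r, 0 < r & forall q, sqdist q p <= r -> A q.
Proof.
split=> [oA p Ap|discA].
  have /nbhs_normP[e /= e0 He] := open_nbhs_nbhs (conj oA Ap).
  exists ((e / 2) ^+ 2); first by rewrite exprn_gt0// divr_gt0.
  move=> q qp; apply: He; rewrite /= prod_normE/= gt_max.
  have e2 : e / 2 < e by rewrite ltr_pdivrMr// ltr_pMr ?ltr1n.
  have small x : x ^+ 2 <= (e / 2) ^+ 2 -> `|x| < e.
    have e20 : 0 <= e / 2 by rewrite divr_ge0// ltW.
    rewrite -(real_normK (num_real x)) ler_pXn2r ?nnegrE//.
    by move=> /le_lt_trans; apply.
  by rewrite distrC small ?[`|p.2 - q.2|]distrC ?small// (le_trans _ qp)//
    /csqnorm /= ?lerDl ?lerDr sqr_ge0.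
rewrite openE => p /discA[r r0 Hr]; apply/(@nbhs_normP _ _ p).
exists (Num.min 1 (r / 2)); first by rewrite /= lt_min ltr01 divr_gt0.
move=> q /=; rewrite prod_normE/= gt_max => /andP[]; rewrite !lt_min.
move=> /andP[p1 r1] /andP[p2 r2]; apply: Hr.
have sq x y : `|x - y| < 1 -> `|x - y| < r / 2 -> (y - x) ^+ 2 <= r / 2.
  move=> xy1 xyr; rewrite -(real_normK (num_real _)) distrC (le_trans _ (ltW xyr))//.
  by rewrite expr2 ler_piMl// ltW.
by rewrite [r]splitr /csqnorm lerD//= sq.
Qed.

(** The interior of the zero set of F in D, in terms of closed discs. *)
Definition zero_interior D F : set (R * R) :=
  [set p | exists2 r, 0 < r & forall q, sqdist q p <= r -> D q /\ F q = 0].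

Lemma sqdist_triangle p q z r s : sqdist q p <= r -> sqdist z q <= s ->
  sqdist z p <= 2 * (r + s).
Proof.
have <- : (z - q) + (q - p) = z - p by rewrite addrA subrK.
move: (z - q) (q - p) => u v; rewrite /csqnorm /= => vr us.
have := sqr_ge0 (u.1 - v.1); have := sqr_ge0 (u.2 - v.2).
rewrite !expr2 in vr us *; lra.
Qed.

Lemma open_zero_interior D F : open (zero_interior D F).
Proof.
apply/open_sqdistP => p [r r0 Hr]; exists (r / 4); first by rewrite divr_gt0.
move=> q qp; exists (r / 4) => [|z zq]; first by rewrite divr_gt0.
by apply: Hr; rewrite (le_trans (sqdist_triangle qp zq))//; lra.
Qed.

(** If p in D is close to some q in the interior of the zero set, compared with
    the distance of p to the complement of D, then [zero_disc_growth] enlarges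
    the disc of zeros around q until it contains a neighbourhood of p.  So a
    point of D outside that interior has a neighbourhood without such q. *)
Lemma open_setD_zero_interior D F : open D ->
  (forall p, D p -> holomorphic_at F p) -> open (D `\` zero_interior D F).
Proof.
move=> /open_sqdistP oD Fholo; apply/open_sqdistP => p [Dp pZ].
have [r r0 Hr] := oD p Dp; exists (r / 100); first by rewrite divr_gt0.
move=> q qp; split; first by apply: Hr; lra.
move=> [e e0 He]; apply: pZ; exists (r / 100); first by rewrite divr_gt0.
move=> z zp; split; first by apply: Hr; lra.
have pq : sqdist p q <= r / 100.
  by move: qp; rewrite /csqnorm/= -(sqrrN (q.1 - p.1)) -(sqrrN (q.2 - p.2)) !opprB.
apply: (@zero_disc_growth F q e (r / 25)) => //.
- move=> u uq; apply/Fholo/Hr/(le_trans (sqdist_triangle qp uq)); lra.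
- by move=> u /He[].
by apply: le_trans (sqdist_triangle pq zp) _; lra.
Qed.

End ZeroSets.

(** * Regular functions on a slice *)

Section Quaternions.
Variable R : realType.
Local Notation H := (quaternion R).
Implicit Types (z : R * R) (I J K a m q : H) (x y : R) (p v : R * R) (g h : R * R -> H).

Lemma quat_normE q :
  `|q| = Num.sqrt (qRe q ^+ 2 + qIi q ^+ 2 + qIj q ^+ 2 + qIk q ^+ 2).
Proof. by case: q. Qed.

Lemma quat_normM m q : `|m * q| = `|m| * `|q|.
Proof.
case: m q => a b c d [a' b' c' d']; rewrite !quat_normE /= -sqrtrM.
  by congr Num.sqrt; ring.
by rewrite !addr_ge0 ?sqr_ge0.
Qed.

Lemma qRe_le_norm q : `|qRe q| <= `|q|.
Proof.
rewrite quat_normE -sqrtr_sqr ler_sqrt; last by rewrite !addr_ge0 ?sqr_ge0.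
by rewrite -!addrA lerDl !addr_ge0 ?sqr_ge0.
Qed.

Lemma qRe_mul_eq0 q : (forall m, qRe (m * q) = 0) -> q = 0.
Proof.
case: q => a b c d /(_ (Quat a (- b) (- c) (- d))) /= q0.
have E : a ^+ 2 + b ^+ 2 + c ^+ 2 + d ^+ 2 = 0 by rewrite -q0; ring.
by apply: quat_norm_eq0; rewrite /= E sqrtr0.
Qed.

Lemma imag_unitN I : imag_units I -> imag_units (- I).
Proof.
move=> [I0 I1]; split; last by rewrite normrN.
by case: I I0 {I1} => ? ? ? ? /= ->; rewrite oppr0.
Qed.

Lemma imag_unit_sqr I : imag_units I -> I * I = - 1.
Proof.
case: I => a b c d [/= ->] I1.
have E : b ^+ 2 + c ^+ 2 + d ^+ 2 = 1.
  have := congr1 (fun r : R => r ^+ 2) I1; rewrite quat_normE /= expr0n add0r expr1n.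
  by rewrite sqr_sqrtr ?addr_ge0 ?sqr_ge0.
rewrite [LHS](_ : _ = Quat (- (b ^+ 2 + c ^+ 2 + d ^+ 2)) 0 0 0).
  by rewrite E; congr Quat; rewrite /= oppr0.
by congr Quat; ring.
Qed.

Lemma is_diff_bounded_linear (V W : normedModType R) (L : V -> W) (M : R) (u : V) :
  linear L -> (forall w : V, `|L w| <= M * `|w|) -> is_diff u L L.
Proof.
move=> Llinear LM.
pose mixL := GRing.isLinear.Build _ _ _ _ _ Llinear.
pose linL : {linear V -> W} := HB.pack L mixL.
have linC : continuous linL.
  apply: bounded_linear_continuous; apply/bounded_funP => r.
  exists (`|M| * r) => w wr; rewrite (le_trans (LM w))//.
  rewrite (le_trans _ (ler_wpM2l (normr_ge0 M) wr))// ler_wpM2r//.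
  exact: ler_norm.
apply: DiffDef; first exact: (linear_differentiable u linC).
exact: (diff_lin u linC).
Qed.

Lemma is_diff_mull a q : is_diff q ( *%R a) ( *%R a).
Proof.
apply: (@is_diff_bounded_linear _ _ _ `|a|) => [k u w|v].
  by rewrite mulrDr scalerAr.
by rewrite quat_normM.
Qed.

Lemma is_diff_qRe q : is_diff q (@qRe R) (@qRe R).
Proof.
apply: (@is_diff_bounded_linear _ _ _ 1) => [k [? ? ? ?] [? ? ? ?]//|v].
by rewrite mul1r qRe_le_norm.
Qed.

(** The differential of g when dg/dx + I dg/dy = 0 and E = dg/dy. *)
Definition left_regular_at I g p :=
  exists E, is_diff p g (fun v => v.1 *: (- (I * E)) + v.2 *: E).

Lemma slice_fun_left_regular Omega f I x y : slice_regular Omega f ->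
  imag_units I -> Omega (slice_point I x y) ->
  left_regular_at I (slice_fun f I) (x, y).
Proof.
move=> [_ freg] I1 /(freg I I1 x y)[df]; rewrite !deriveE//.
set g := slice_fun f I in df *; set E := 'd g (x, y) (0, 1) => CR; exists E.
have {}CR : 'd g (x, y) (1, 0) = - (I * E).
  move/eqP: CR; rewrite scaler_eq0 invr_eq0 pnatr_eq0/= addr_eq0.
  by move/eqP.
apply: DiffDef => //; apply/funext => -[s t] /=; rewrite -CR -!linearZ -linearD.
congr ('d g _ _); congr pair.
  by rewrite -[RHS]/(s * 1 + t * 0) mulr0 mulr1 addr0.
by rewrite -[RHS]/(s * 0 + t * 1) mulr0 mulr1 add0r.
Qed.

Lemma left_regular_sub I g h p : left_regular_at I g p -> left_regular_at I h p ->
  left_regular_at I (fun z => g z - h z) p.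
Proof.
move=> [E dg] [E' dh]; exists (E - E').
apply: is_diff_ext (is_diffB dg dh) _ => v.
rewrite [LHS](_ : _ = v.1 *: (- (I * E)) + v.2 *: E
  - (v.1 *: (- (I * E')) + v.2 *: E'))//.
by rewrite mulrBr !scalerN !scalerBr !opprD !opprK addrACA.
Qed.

(** The relation a K = I a transports the equation for K to the one for I. *)
Lemma left_regular_mull I K a g p : a * K = I * a ->
  left_regular_at K g p -> left_regular_at I (fun z => a * g z) p.
Proof.
move=> aK [E dg]; exists (a * E).
apply: is_diff_ext (is_diff_compose dg (is_diff_mull a _)) _ => v.
by rewrite mulrDr -!scalerAr mulrN !mulrA aK.
Qed.

(** Left multiplication by I makes the quaternions a complex vector space, and
    q |-> Re (m q) - i Re (m I q) is a complex linear functional on it; composed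
    with g it gives a holomorphic function. *)
Lemma left_regular_holomorphic I g m p : I * I = - 1 -> left_regular_at I g p ->
  holomorphic_at (fun z => (qRe (m * g z), - qRe (m * (I * g z)))) p.
Proof.
move=> II [E dg]; exists (- qRe (m * (I * E)), - qRe (m * E)).
have dRe a : is_diff p (fun z => qRe (a * g z))
    (fun v => qRe (a * (v.1 *: (- (I * E)) + v.2 *: E))).
  have dag := is_diff_compose dg (is_diff_mull a _).
  exact: is_diff_compose dag (is_diff_qRe _).
have dIm : is_diff p (fun z => - qRe (m * (I * g z)))
    (fun v => - qRe (m * I * (v.1 *: (- (I * E)) + v.2 *: E))).
  by under eq_fun do rewrite mulrA; exact: is_diffN (dRe (m * I)).
have qReD : {morph @qRe R : u w / u + w} by case=> ? ? ? ? [].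
have qReN : {morph @qRe R : u / - u} by case.
have qReZ k : {morph @qRe R : u / k *: u >-> k * u} by case.
apply: is_diff_ext (is_diff_pair (dRe m) dIm) _ => v.
rewrite /cmul !mulrDr -!scalerAr !mulrN !mulrA -(mulrA m I I) II.
by rewrite mulrN1 mulNr opprK !(qReD, qReZ, qReN); congr pair => /=; ring.
Qed.

End Quaternions.

(** * The identity principle and the representation formula *)

Section Representation.
Variable R : realType.
Local Notation H := (quaternion R).
Implicit Types (I J K a b q : H) (x y : R) (p : R * R) (g : R * R -> H).
Implicit Types (Omega : set H) (f : H -> H).

Lemma half_double q : 2^-1 *: (q + q) = q.
Proof. by rewrite -mulr2n -[q *+ 2]scaler_nat scalerA mulVf ?scale1r. Qed.

Lemma slice_point_real I x : slice_point I x 0 = x%:A.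
Proof. by rewrite /slice_point scale0r addr0. Qed.

Lemma slice_pointN I x y : slice_point (- I) x y = slice_point I x (- y).
Proof. by rewrite /slice_point scalerN scaleNr. Qed.

(** Inverse to [slice_point] on the plane of I, defined on all quaternions so that
    relatively open and closed subsets of the slice arise as preimages. *)
Definition slice_coord I q : R * R := (qRe q, - qRe (I * q)).

Lemma slice_coordK I x y : imag_units I ->
  slice_coord I (slice_point I x y) = (x, y).
Proof.
case: I => a b c d I1; have := imag_unit_sqr I1; have [/= -> _] := I1.
rewrite /slice_coord /slice_point => /(congr1 (@qRe R)) /= II.
congr pair; rewrite /=; first by ring.
transitivity (- y * (0 * 0 - b * b - c * c - d * d)); first by ring.
by rewrite II mulrN1 opprK.
Qed.

Lemma slice_coord_continuous I : continuous (slice_coord I).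
Proof.
move=> q; apply: differentiable_continuous; apply: differentiable_pair.
  by have dRe := is_diff_qRe q; exact: ex_diff.
apply: differentiableN.
have dIRe := is_diff_compose (is_diff_mull I q) (is_diff_qRe _).
exact: ex_diff.
Qed.

Lemma slice_point_continuous I : continuous (fun p => slice_point I p.1 p.2).
Proof.
move=> p; apply: cvgD; apply: cvgZr_tmp.
  exact: cvg_fst.
exact: cvg_snd.
Qed.

(** The zeros on the real axis produce a first disc of zeros. *)
Lemma real_point_interior (D : set (R * R)) (F : R * R -> R * R) x :
  open D -> (forall p, D p -> holomorphic_at F p) ->
  (forall x, D (x, 0) -> F (x, 0) = 0) -> D (x, 0) -> zero_interior D F (x, 0).
Proof.
move=> /open_sqdistP oD Fholo Freal /oD[r r0 Hr].
pose e := Num.min 1 (r / 5).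
have e0 : 0 < e by rewrite lt_min ltr01 divr_gt0.
have e1 : e <= 1 by rewrite ge_min lexx.
have e5 : e <= r / 5 by rewrite ge_min lexx orbT.
have sq (u l : R) : 0 < l -> `|u| <= l -> u ^+ 2 <= l ^+ 2.
  by move=> l0 ul; rewrite -(real_normK (num_real u)) ler_pXn2r ?nnegrE// ltW.
have box z : `|z.1 - x| <= e -> `|z.2| <= 2 * e -> D z.
  move=> /(sq _ _ e0) z1 /sq z2; apply: Hr.
  have {}z2 := z2 (mulr_gt0 (ltr0n _ 2) e0).
  rewrite /csqnorm /= subr0 (le_trans (lerD z1 z2))//.
  by rewrite !expr2; nra.
exists (e ^+ 2 / 2); first by rewrite divr_gt0// exprn_gt0.
move=> z; rewrite /csqnorm /= subr0 => zx.
have ze : `|z.1 - x| + `|z.2| <= e.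
  rewrite -(ler_pXn2r (ltn0Sn 1)) ?nnegrE ?addr_ge0 ?(ltW e0)//.
  have := sqr_ge0 (`|z.1 - x| - `|z.2|); move: zx.
  rewrite -(real_normK (num_real (z.1 - x))) -(real_normK (num_real z.2)).
  move: `|z.1 - x| `|z.2| => u v; rewrite !expr2; lra.
split.
  apply: box; first by rewrite (le_trans _ ze)// lerDl.
  rewrite (le_trans (_ : _ <= e))// ?(le_trans _ ze) ?lerDr//.
  by rewrite mulr_natl mulr2n lerDl ltW.
apply: (@zero_near_real_segment _ F x e) ze => [w w1 w2|u u1].
  exact/Fholo/box.
by apply/Freal/box; rewrite //= normr0 mulr_ge0// ltW.
Qed.

(** The interior of the zero set is nonempty, open and relatively closed in the
    connected slice, hence is the whole slice.  This is applied to each of the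
    holomorphic functions obtained from g by the functionals indexed by m. *)
Lemma slice_identity Omega I g : slice_domain Omega -> imag_units I ->
  (forall x y, Omega (slice_point I x y) -> left_regular_at I g (x, y)) ->
  (forall x, Omega x%:A -> g (x, 0) = 0) ->
  forall x y, Omega (slice_point I x y) -> g (x, y) = 0.
Proof.
move=> [[_ _ oOmega] [q0 [Oq0 [x0 q0x0]]] slices] I1 greg greal x y Oxy.
have [_ conn _] := slices I I1.
apply: qRe_mul_eq0 => m.
pose F p := (qRe (m * g p), - qRe (m * (I * g p))).
pose D : set (R * R) := [set p | Omega (slice_point I p.1 p.2)].
have oD : open D.
  by apply: open_comp => // p _; exact: slice_point_continuous.
have Fholo p : D p -> holomorphic_at F p.
  case: p => s t Dst; apply: left_regular_holomorphic; last exact: greg.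
  exact: imag_unit_sqr.
have qRe0 : qRe (0 : H) = 0 by [].
have Freal s : D (s, 0) -> F (s, 0) = 0.
  rewrite /D/= slice_point_real => /greal gs0.
  by rewrite /F gs0 !mulr0 qRe0 oppr0.
pose Z := zero_interior D F.
suff ZD : forall p, D p -> Z p.
  have [r r0 /(_ (x, y))] := ZD (x, y) Oxy.
  by rewrite subrr /csqnorm /= expr0n addr0 => /(_ (ltW r0)) [_ []].
have Dx0 : D (x0, 0) by rewrite /D/= slice_point_real -q0x0.
pose B : set (subspace (slice_plane I)) :=
  (Omega `&` slice_plane I) `&` slice_coord I @^-1` Z.
have BE : B = Omega `&` slice_plane I :> set H.
  apply: conn.
  - exists (slice_point I x0 0); split; last first.
      by rewrite /preimage/= slice_coordK//; exact: real_point_interior.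
    by split; [exact: Dx0|exists x0, 0].
  - exists (slice_coord I @^-1` Z) => //; apply: open_subspaceW.
    apply: open_comp (@open_zero_interior _ D F) => q _.
    exact: slice_coord_continuous.
  - exists (~` (slice_coord I @^-1` (D `\` Z))).
      apply: open_closedC; apply: open_subspaceW; apply: open_comp.
        by move=> q _; exact: slice_coord_continuous.
      exact: open_setD_zero_interior.
    rewrite /B; apply/seteqP; split=> q [[Oq [s [t qst]]] Zq]; split;
      try by split=> //; exists s, t.
      by move=> [_ /(_ Zq)].
    move: Zq; rewrite /setC/= /preimage/= qst slice_coordK// => nDZ.
    by apply: contrapT => nZ; apply: nDZ; split=> //; rewrite /D/= -qst.
move=> [s t] Dst; have : B (slice_point I s t).
  by rewrite BE; split=> //; exists s, t.
by move=> [_]; rewrite /preimage/= slice_coordK.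
Qed.

(** The right-hand side satisfies the Cauchy-Riemann equation for I, since its
    coefficients intertwine J and - J with I, and agrees with f at real points. *)
Lemma representation_formula Omega f I J x y : slice_domain Omega ->
  circular Omega -> slice_regular Omega f -> imag_units I -> imag_units J ->
  Omega (slice_point I x y) ->
  f (slice_point I x y) =
    2^-1 *: (1 - I * J) * f (slice_point J x y)
    + 2^-1 *: (1 + I * J) * f (slice_point J x (- y)).
Proof.
move=> sdom circ freg I1 J1.
pose a := 2^-1 *: (1 - I * J) : H; pose b := 2^-1 *: (1 + I * J) : H.
have [II JJ] := (imag_unit_sqr I1, imag_unit_sqr J1).
have aJ : a * J = I * a.
  rewrite -scalerAl -scalerAr; congr (_ *: _).
  by rewrite mulrBl mulrBr -mulrA JJ mulrA II mul1r mulr1 !mulrN1 mulN1r !opprK addrC.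
have bJ : b * - J = I * b.
  rewrite -scalerAl -scalerAr; congr (_ *: _).
  rewrite mulrDl mulrDr mulrN -mulrA mulrN JJ mulrA II.
  by rewrite mul1r mulr1 opprK mulr1 mulN1r addrC.
pose g p := slice_fun f I p - a * slice_fun f J p - b * slice_fun f (- J) p.
suff g0 : forall s t, Omega (slice_point I s t) -> g (s, t) = 0.
  move=> /g0/eqP; rewrite /g /slice_fun /= slice_pointN -addrA -opprD subr_eq0.
  by move=> /eqP.
apply: slice_identity => // [s t Ost|s _].
  have sphere K : imag_units K -> Omega (slice_point K s t).
    by move=> K1; apply: (circ I s t I1 Ost); exists K.
  apply: left_regular_sub; first apply: left_regular_sub.
  - exact: slice_fun_left_regular freg I1 Ost.
  - apply: left_regular_mull aJ _.
    exact: slice_fun_left_regular freg J1 (sphere _ J1).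
  - have NJ1 := imag_unitN J1.
    apply: left_regular_mull bJ _.
    exact: slice_fun_left_regular freg NJ1 (sphere _ NJ1).
rewrite /g /slice_fun /= !slice_point_real -addrA -opprD -mulrDl.
have -> : a + b = 1.
  by rewrite -scalerDr addrACA addNr addr0 half_double.
by rewrite mul1r subrr.
Qed.

End Representation.

Theorem theorem2p26 (R : realType) (Omega : set (quaternion R))
    (f : quaternion R -> quaternion R)
    (Omega_sdomain : slice_domain Omega) (Omega_circular : circular Omega)
    (f_regular : slice_regular Omega f) :
  (forall J : quaternion R, imag_units J ->
   forall (x y : R) (I : quaternion R), imag_units I ->
     Omega (x%:A + y *: I) ->
     f (x%:A + y *: I) =
       2^-1 *: (f (x%:A + y *: J) + f (x%:A - y *: J))
       + I * (2^-1 *: (J * (f (x%:A - y *: J) - f (x%:A + y *: J)))))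
  /\
  (forall x y : R, slice_sphere x y `<=` Omega ->
   exists b c : quaternion R, forall K : quaternion R, imag_units K ->
     2^-1 *: (f (x%:A + y *: K) + f (x%:A - y *: K)) = b /\
     2^-1 *: (K * (f (x%:A - y *: K) - f (x%:A + y *: K))) = c).
Proof.
have formula J : imag_units J -> forall x y I, imag_units I ->
    Omega (x%:A + y *: I) -> f (x%:A + y *: I) =
      2^-1 *: (f (x%:A + y *: J) + f (x%:A - y *: J))
      + I * (2^-1 *: (J * (f (x%:A - y *: J) - f (x%:A + y *: J)))).
  move=> J1 x y I I1 Oxy.
  have := representation_formula Omega_sdomain Omega_circular f_regular I1 J1 Oxy.
  rewrite /slice_point scaleNr => ->.
  move: (f (_ + _)) (f (_ - _)) => u v.
  rewrite -!scalerAl -scalerAr -!scalerDr; congr (_ *: _).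
  by rewrite mulrBl mulrDl !mul1r mulrA mulrBr addrACA; congr (_ + _); rewrite addrC.
split=> // x y sphere.
(* Any unit would do: the witnesses are the coefficients of the formula for this J. *)
pose J : quaternion R := Quat 0 1 0 0.
have J1 : imag_units J.
  by split=> //; rewrite quat_normE /= !expr0n expr1n add0r !addr0 sqrtr1.
exists (2^-1 *: (f (x%:A + y *: J) + f (x%:A - y *: J))).
exists (2^-1 *: (J * (f (x%:A - y *: J) - f (x%:A + y *: J)))).
move=> K K1; have NK1 := imag_unitN K1.
have fK := formula J J1 x y K K1 (sphere _ (ex_intro2 _ _ K K1 erefl)).
have := formula J J1 x y (- K) NK1 (sphere _ (ex_intro2 _ _ (- K) NK1 erefl)).
rewrite scalerN mulNr => fNK; move: fK fNK.
move: (2^-1 *: _) (2^-1 *: _) => b c -> ->.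
have KK := imag_unit_sqr K1.
split.
  by rewrite addrACA subrr addr0 half_double.
rewrite opprD addrACA subrr add0r -opprD -mulrDr mulrN mulrA KK mulN1r opprK.
by rewrite half_double.
Qed.
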